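(* Let $C\subset S^{D-1}$ and $Y\subset S^{k-1}$ be kissing configurations, let $t_1,\dots,t_\ell\in\mathbb{R}^k$ ($\ell\ge1$) be distinct with $0<\|t_i\|<1$, put $a_i=\sqrt{1-\|t_i\|^2}$, let $A_1,\dots,A_\ell\subseteq C$, $U=\bigcup_iA_i$, and let $$X=\{(x,0):x\in C\setminus U\}\cup\bigcup_{i=1}^{\ell}\{(a_i x,t_i):x\in A_i\}\cup\{(0,y):y\in Y\}\subset\mathbb{R}^{D+k}.$$ Let $\Gamma$ be the graph on the label set $\{1,\dots,\ell\}$ in which distinct $i,j$ are adjacent if and only if $a_ia_j+\langle t_i,t_j\rangle\le\frac12$. Suppose $X$ is a kissing configuration and $|A_i|\le\alpha_i$ for each $i$. If nonnegative numbers $\lambda_1,\dots,\lambda_\ell$ satisfy $$\sum_{i\in J}\lambda_i\ge|J|-1\quad\text{for every nonempty clique }J\text{ of }\Gamma,$$ then $$|X|\le|C|+|Y|+\sum_{i=1}^\ell\lambda_i\alpha_i .$$ Equality holds exactly when $\sum_{i\in J(x)}\lambda_i=|J(x)|-1$ for every $x\in U$, where $J(x)=\{i:x\in A_i\}$, and $|A_i|=\alpha_i$ for every $i$ with $\lambda_i>0$.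
   Context: A kissing configuration in $S^{n-1}\subset\mathbb{R}^n$ is a set of unit vectors whose distinct members have inner product at most $\tfrac12$. A clique is a set of pairwise adjacent vertices (single vertices are cliques). *)

(* Defs.v *)
From mathcomp Require Import all_boot all_order all_algebra.
From mathcomp Require Import finmap.
From mathcomp Require Import all_classical reals topology normedtype.
From mathcomp Require Import ring lra.
Set Implicit Arguments.
Unset Strict Implicit.
Unset Printing Implicit Defensive.
Import Order.TTheory GRing.Theory Num.Theory.
Import numFieldNormedType.Exports.
Local Open Scope classical_set_scope.
Local Open Scope ring_scope.

Definition dot (R : realType) (n : nat) (u v : 'rV[R]_n) : R :=
  \sum_(j < n) u 0 j * v 0 j.

(* The library norm `|u| on 'rV[R]_n is the sup norm, not this one. *)
Definition enorm (R : realType) (n : nat) (u : 'rV[R]_n) : R :=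
  Num.sqrt (dot u u).

Definition kissing (R : realType) (n : nat) (K : set 'rV[R]_n) : Prop :=
  (forall u, K u -> enorm u = 1) /\
  (forall u v, K u -> K v -> u <> v -> dot u v <= 2^-1).

Definition clique (I : finType) (e : rel I) (J : {set I}) : Prop :=
  forall i j, i \in J -> j \in J -> i != j -> e i j.

(* Equal to 0 on infinite sets; by [kissing_finite] below, this never occurs
   for kissing configurations and their subsets. *)
Definition ncard (T : choiceType) (A : set T) : nat := #|` fset_set A|%fset.

Definition height (R : realType) (k : nat) (t : 'rV[R]_k) : R :=
  Num.sqrt (1 - enorm t ^+ 2).

Definition lifted (R : realType) (D k l : nat) (C : set 'rV[R]_D)
    (Y : set 'rV[R]_k) (t : 'I_l -> 'rV[R]_k) (A : 'I_l -> set 'rV[R]_D) :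
    set 'rV[R]_(D + k) :=
  [set row_mx x 0 | x in C `\` \bigcup_i A i]
  `|` \bigcup_i [set row_mx (height (t i) *: x) (t i) | x in A i]
  `|` [set row_mx 0 y | y in Y].

Definition label_adj (R : realType) (k l : nat) (t : 'I_l -> 'rV[R]_k) :
    rel 'I_l :=
  fun i j => (i != j) &&
    (height (t i) * height (t j) + dot (t i) (t j) <= 2^-1).

Definition labels (R : realType) (D l : nat) (A : 'I_l -> set 'rV[R]_D)
    (x : 'rV[R]_D) : {set 'I_l} :=
  finset (fun i => x \in A i).

Lemma dot_enorm1 (R : realType) (n : nat) (u : 'rV[R]_n) :
  enorm u = 1 -> dot u u = 1.
Proof.
move=> u1; have u0 : 0 <= dot u u.
  by apply: sumr_ge0 => j _; rewrite -expr2 sqr_ge0.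
by rewrite -(sqr_sqrtr u0) -/(enorm u) u1 expr1n.
Qed.

Lemma kissing_finite (R : realType) (n : nat) (K : set 'rV[R]_n) :
  kissing K -> finite_set K.
Proof.
move=> [K1 K2].
pose r : R := (2 * n.+1%:R)^-1.
have r0 : 0 < r by rewrite invr_gt0 mulr_gt0.
have sep (c u v : 'rV[R]_n) : K u -> K v -> ball c r u -> ball c r v -> u = v.
  move=> Ku Kv cu cv; apply: contrapT => uv.
  have := K2 _ _ Ku Kv uv; apply/negP; rewrite -ltNge.
  have dE : \sum_(j < n) (u 0 j - v 0 j) ^+ 2 = 2 - 2 * dot u v.
    transitivity (dot u u + dot v v - 2 * dot u v).
      rewrite /dot mulr_sumr -big_split -sumrB /=.
      by apply: eq_bigr => j _; ring.
    by rewrite !dot_enorm1 ?K1//; ring.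
  suff : \sum_(j < n) (u 0 j - v 0 j) ^+ 2 < 1 by rewrite dE; lra.
  have le_r j : (u 0 j - v 0 j) ^+ 2 <= (n.+1%:R^-1) ^+ 2.
    have rE : n.+1%:R^-1 = 2 * r :> R by rewrite /r invfM mulrA divff ?mul1r ?pnatr_eq0.
    have hu : `|c 0 j - u 0 j| < r by case: cu => _; apply.
    have hv : `|c 0 j - v 0 j| < r by case: cv => _; apply.
    rewrite rE -[leLHS]real_normK ?num_real//.
    rewrite lerXn2r ?nnegrE ?mulr_ge0 ?(ltW r0)//.
    have := ler_normB (c 0 j - v 0 j) (c 0 j - u 0 j).
    rewrite (_ : c 0 j - v 0 j - (c 0 j - u 0 j) = u 0 j - v 0 j); last ring.
    lra.
  apply: (@le_lt_trans _ _ (\sum_(j < n) (n.+1%:R^-1) ^+ 2)).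
    by apply: ler_sum.
  rewrite sumr_const card_ord -[ltLHS]mulr_natl exprVn.
  rewrite ltr_pdivrMr ?exprn_gt0 ?ltr0n// mul1r -natrX ltr_nat.
  by rewrite expnS expn1 leq_pmulr.
pose B : set 'rV[R]_n := [set u | forall j, `[-1, 1]%classic (u 0 j)].
have cB : compact B by apply: (@rV_compact R n (fun=> `[-1, 1]%classic)) => j; exact: segment_compact.
have KB : K `<=` B.
  move=> u Ku j; rewrite /= in_itv /= -ler_norml.
  rewrite -(@ler_pXn2r _ 2) ?nnegrE// expr1n real_normK ?num_real//.
  rewrite -(dot_enorm1 (K1 _ Ku)) /dot (bigD1 j)//= -expr2 lerDl.
  by apply: sumr_ge0 => i _; rewrite -expr2 sqr_ge0.
rewrite compact_cover in cB.
have [|c _|F _ BF] := cB _ setT (fun c : 'rV[R]_n => (ball c r)°).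
- by move=> c _; exact: open_interior.
- by exists c => //; apply: nbhsx_ballx.
pose f (u : 'rV[R]_n) : 'rV[R]_n := xget 0 [set c | c \in F /\ ball c r u].
have fP u : K u -> f u \in F /\ ball (f u) r u.
  move=> Ku; rewrite /f; case: xgetP => [c _ //|].
  have [c cF cu] := BF u (KB _ Ku).
  by move=> /(_ c) []; split=> //; exact: interior_subset cu.
have fi : {in K &, injective f}.
  move=> u v; rewrite !inE => Ku Kv fuv.
  have [_ fu] := fP u Ku; have [_ fv] := fP v Kv.
  by apply: (sep (f u)) => //; rewrite fuv.
rewrite -(eq_finite_set (inj_card_eq fi)).
apply: (@sub_finite_set _ _ [set` F]); last exact: finite_fset.
by move=> _ [u Ku <-]; have [] := fP u Ku.
Qed.

(* Main.v *)
(* An element x of U contributes one point to C but |J(x)| points to X, so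
   |X| = |C| + |Y| + \sum_(x in U) (|J(x)| - 1). Since X is kissing, J(x) is a
   clique of \Gamma: two lifts of x by i and j have inner product
   a_i a_j + <t_i, t_j>. Thus |J(x)| - 1 is at most the lambda-weight of J(x),
   and summing these weights over x gives \sum_i lambda_i |A_i|, which is at
   most \sum_i lambda_i alpha_i. The gap in the bound is thereby a sum of
   nonnegative terms, and the equality case is that of all terms vanishing. *)
Require Import Defs.
From mathcomp Require Import all_boot all_order all_algebra.
From mathcomp Require Import finmap.
From mathcomp Require Import all_classical reals.
From mathcomp Require Import ring lra.
Set Implicit Arguments.
Unset Strict Implicit.
Unset Printing Implicit Defensive.
Import Order.TTheory GRing.Theory Num.Theory.
Local Open Scope classical_set_scope.
Local Open Scope ring_scope.

Section Cardinality.
Variable T : choiceType.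

(** Writing cardinalities as sums of indicators over one common finite set lets them be subtracted
    termwise and double counted. *)
Lemma ncard_sum_mem (A B : set T) : finite_set B -> A `<=` B ->
  ncard A = (\sum_(x <- fset_set B) (x \in A))%N.
Proof.
move=> finB AB; have finA := sub_finite_set AB finB.
rewrite /ncard -big_mkcond /= -big_filter sum1_size.
apply: perm_size; apply: uniq_perm; rewrite ?filter_uniq ?fset_uniq// => x.
rewrite mem_filter !in_fset_set// andb_idr// !inE; exact: AB.
Qed.

Lemma ncard_setU (A B : set T) : finite_set A -> finite_set B ->
  (forall x, A x -> B x -> False) -> ncard (A `|` B) = (ncard A + ncard B)%N.
Proof.
move=> finA finB AB0; rewrite /ncard fset_setU// -cardfsUI -fset_setI//.
rewrite (_ : A `&` B = set0) ?fset_set0 ?cardfs0 ?addn0//.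
by rewrite -subset0 => x [/AB0].
Qed.

(** Double counting over the union: by disjointness each of its points lies in exactly one [F i], so
    its indicators sum to 1. *)
Lemma ncard_bigcup (I : finType) (F : I -> set T) :
  (forall i, finite_set (F i)) ->
  (forall i j x, F i x -> F j x -> i = j) ->
  ncard (\bigcup_i F i) = (\sum_i ncard (F i))%N.
Proof.
move=> finF F_disj.
have finU : finite_set (\bigcup_i F i) by exact: bigcup_finite.
have subU i : F i `<=` \bigcup_i F i by exact: bigcup_sup.
under [RHS]eq_bigr do rewrite (ncard_sum_mem finU (@subU _)).
rewrite exchange_big /= /ncard -sum1_size big_seq [RHS]big_seq.
apply: eq_bigr => x; rewrite in_fset_set// inE => -[i _ Fix].
rewrite (bigD1 i)//= mem_set// big1// => j ji.
by rewrite memNset// => /(F_disj _ _ _ Fix) ij; rewrite ij eqxx in ji.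
Qed.

End Cardinality.

Lemma ncard_image (T U : choiceType) (f : T -> U) (A : set T) :
  finite_set A -> {in A &, injective f} -> ncard (f @` A) = ncard A.
Proof.
move=> finA f_inj; rewrite /ncard fset_set_image// card_in_imfset//= => x y.
rewrite !in_fset_set//; exact: f_inj.
Qed.

Section Lifting.
Variable R : realType.

Lemma enorm0 (n : nat) : enorm (0 : 'rV[R]_n) = 0.
Proof. by rewrite /enorm /dot big1 ?sqrtr0// => j _; rewrite mxE mul0r. Qed.

Lemma dot_row_mx (m n : nat) (u v : 'rV[R]_m) (x y : 'rV[R]_n) :
  dot (row_mx u x) (row_mx v y) = dot u v + dot x y.
Proof.
rewrite /dot big_split_ord; congr (_ + _); apply: eq_bigr => j _.
  by rewrite !row_mxEl.
by rewrite !row_mxEr.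
Qed.

Lemma dotZ (n : nat) (a b : R) (u v : 'rV[R]_n) :
  dot (a *: u) (b *: v) = a * b * dot u v.
Proof. by rewrite /dot mulr_sumr; apply: eq_bigr => j _; rewrite !mxE; ring. Qed.

Variables (D k l : nat) (C : set 'rV[R]_D) (Y : set 'rV[R]_k).
Variables (t : 'I_l -> 'rV[R]_k) (A : 'I_l -> set 'rV[R]_D).
Hypotheses (C_kissing : kissing C) (Y_kissing : kissing Y).
Hypotheses (t_inj : injective t) (t_norm : forall i, 0 < enorm (t i) < 1).
Hypothesis A_sub : forall i, A i `<=` C.

Lemma height_gt0 i : 0 < height (t i).
Proof.
have /andP[t0 t1] := t_norm i.
by rewrite sqrtr_gt0 subr_gt0 expr_lt1// ltW.
Qed.

Lemma kissing_neq0 (n : nat) (K : set 'rV[R]_n) u : kissing K -> K u -> u <> 0.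
Proof.
move=> [K1 _] /K1 + u0; rewrite u0 enorm0 => /esym/eqP.
by rewrite oner_eq0.
Qed.

Lemma t_neq0 i : t i <> 0.
Proof. by have := t_norm i => /[swap] ->; rewrite enorm0 ltxx. Qed.

Lemma finite_layer i : finite_set (A i).
Proof. by apply: sub_finite_set (kissing_finite C_kissing); exact: A_sub. Qed.

(** All pieces are disjoint. The last [k] coordinates separate the layers from each other, as [t] is
    injective, and from the unlifted points, as [t i] is nonzero. The copy of [Y] avoids the
    unlifted points because [y] is nonzero, and the layers because [height (t i) *: x] is nonzero.
    Positive heights also make each lift injective. *)
Lemma ncard_lifted :
  ncard (lifted C Y t A) =
  (ncard (C `\` \bigcup_i A i) + \sum_(i < l) ncard (A i) + ncard Y)%N.
Proof.
have finC := kissing_finite C_kissing.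
have finY := kissing_finite Y_kissing.
have finCU : finite_set (C `\` \bigcup_i A i) by exact: finite_setD.
have finl i : finite_set [set row_mx (height (t i) *: x) (t i) | x in A i].
  by apply: finite_image; exact: finite_layer.
have finU : finite_set
  (\bigcup_i [set row_mx (height (t i) *: x) (t i) | x in A i]).
  exact: bigcup_finite.
rewrite /lifted ncard_setU; first last.
- move=> _ [[x [Cx _] <-]|[i _ [x Ax <-]]] [y Yy] /eq_row_mx[].
    by move=> _; exact: kissing_neq0 Y_kissing Yy.
  move=> /esym/eqP; rewrite scaler_eq0 gt_eqF ?height_gt0//= => /eqP x0 _.
  exact: kissing_neq0 C_kissing (A_sub Ax) x0.
- exact: finite_image.
- by rewrite finite_setU; split=> //; exact: finite_image.
rewrite ncard_setU//; first last.
- move=> _ [x _ <-] [i _ [y _ /eq_row_mx[_]]]; exact: t_neq0.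
- exact: finite_image.
rewrite ncard_bigcup//; last first.
  by move=> i j _ [x _ <-] [y _ /eq_row_mx[_ /t_inj]].
congr (_ + _ + _)%N.
- by apply: ncard_image => // x y _ _ /eq_row_mx[].
- apply: eq_bigr => i _; apply: ncard_image; first exact: finite_layer.
  move=> x y _ _ /eq_row_mx[+ _]; apply: scalerI.
  by rewrite gt_eqF ?height_gt0.
- by apply: ncard_image => // x y _ _ /eq_row_mx[].
Qed.

Lemma clique_labels x : kissing (lifted C Y t A) -> C x ->
  clique (label_adj t) (labels A x).
Proof.
move=> [_ X2] Cx i j; rewrite !inE => Aix Ajx ij.
rewrite /label_adj ij /=.
have lift_in h : A h x -> lifted C Y t A (row_mx (height (t h) *: x) (t h)).
  by move=> Ahx; left; right; exists h => //; exists x.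
have := X2 _ _ (lift_in i Aix) (lift_in j Ajx).
rewrite dot_row_mx dotZ dot_enorm1 ?mulr1; last by case: C_kissing => ->.
(* It remains to see that the two lifts are distinct: their last [k] coordinates are [t i] and
   [t j]. *)
apply; move=> /eq_row_mx[_ /t_inj] ijE; by rewrite ijE eqxx in ij.
Qed.

Lemma card_labels x : #|labels A x| = (\sum_(i < l) (x \in A i))%N.
Proof.
by rewrite -sum1_card big_mkcond; apply: eq_bigr => i _; rewrite inE; case: ifP.
Qed.

Lemma labels_neq0 x : (labels A x != finset.set0) = (x \in \bigcup_i A i).
Proof.
apply/set0Pn/idP => [[i]|]; rewrite !inE.
  by exists i.
by move=> [i _ Aix]; exists i; rewrite !inE.
Qed.

(** An exact identity for the gap serves both the bound and its equality case. The indicator of the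
    union replaces the constant 1 so that points outside the union, which have no labels, contribute
    0 and the sum can run over all of [C]. *)
Lemma bound_gap (alpha lambda : 'I_l -> R) :
  (ncard C)%:R + (ncard Y)%:R + \sum_(i < l) lambda i * alpha i
    - (ncard (lifted C Y t A))%:R =
  \sum_(x <- fset_set C) (\sum_(i in labels A x) lambda i
       - (#|labels A x|%:R - (x \in \bigcup_i A i)%:R))
  + \sum_(i < l) lambda i * (alpha i - (ncard (A i))%:R).
Proof.
have finC := kissing_finite C_kissing.
(* Both sides count the union of the [A i]. *)
have CE : (ncard C)%:R - (ncard (C `\` \bigcup_i A i))%:R =
    \sum_(x <- fset_set C) (x \in \bigcup_i A i)%:R :> R.
  rewrite (ncard_sum_mem finC (@subset_refl _ C)).
  rewrite (@ncard_sum_mem _ (C `\` _) C)//.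
  rewrite !natr_sum -sumrB big_seq [RHS]big_seq; apply: eq_bigr => x.
  rewrite in_fset_set// => Cx; rewrite in_setD Cx /=.
  by case: (x \in \bigcup_i A i); rewrite ?subrr ?subr0.
have nA i : (ncard (A i))%:R = \sum_(x <- fset_set C) (x \in A i)%:R :> R.
  by rewrite (ncard_sum_mem finC (@A_sub i)) natr_sum.
(* [JE] and [LE] count the pairs of a point [x] and a label [i] with [x] in [A i], first with weight
   1, then with weight [lambda i]. *)
have JE : \sum_(x <- fset_set C) #|labels A x|%:R =
    \sum_(i < l) (ncard (A i))%:R :> R.
  under [RHS]eq_bigr do rewrite nA.
  rewrite exchange_big; apply: eq_bigr => x _.
  by rewrite card_labels natr_sum.
have LE : \sum_(x <- fset_set C) \sum_(i in labels A x) lambda i =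
    \sum_(i < l) lambda i * (ncard (A i))%:R.
  under [RHS]eq_bigr do rewrite nA mulr_sumr.
  rewrite exchange_big; apply: eq_bigr => x _.
  rewrite big_mkcond; apply: eq_bigr => i _; rewrite inE.
  by case: ifP; rewrite ?mulr1 ?mulr0.
under [X in _ = _ + X]eq_bigr do rewrite mulrBr.
rewrite !sumrB LE JE -CE ncard_lifted !natrD natr_sum; ring.
Qed.

End Lifting.

Theorem proposition2p2 (R : realType) (D k l : nat)
    (C : set 'rV[R]_D) (Y : set 'rV[R]_k)
    (t : 'I_l -> 'rV[R]_k) (A : 'I_l -> set 'rV[R]_D)
    (alpha lambda : 'I_l -> R)
    (l_gt0 : (0 < l)%N)
    (C_kissing : kissing C) (Y_kissing : kissing Y)
    (t_inj : injective t)
    (t_norm : forall i, 0 < enorm (t i) < 1)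
    (A_sub : forall i, A i `<=` C)
    (X_kissing : kissing (lifted C Y t A))
    (A_card : forall i, (ncard (A i))%:R <= alpha i)
    (lambda_ge0 : forall i, 0 <= lambda i)
    (lambda_clique : forall J : {set 'I_l}, J != finset.set0 ->
       clique (label_adj t) J -> #|J|%:R - 1 <= \sum_(i in J) lambda i) :
  (ncard (lifted C Y t A))%:R
    <= (ncard C)%:R + (ncard Y)%:R + \sum_(i < l) lambda i * alpha i
  /\
  ((ncard (lifted C Y t A))%:R
     = (ncard C)%:R + (ncard Y)%:R + \sum_(i < l) lambda i * alpha i
   <->
   (forall x, (\bigcup_i A i) x ->
      \sum_(i in labels A x) lambda i = #|labels A x|%:R - 1)
   /\ (forall i, 0 < lambda i -> (ncard (A i))%:R = alpha i)).
Proof.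
have finC := kissing_finite C_kissing.
have gapE := bound_gap C_kissing Y_kissing t_inj t_norm A_sub alpha lambda.
have labels_out x : x \notin \bigcup_i A i -> labels A x = finset.set0.
  by rewrite -labels_neq0 negbK => /eqP.
have point_ge0 x : x \in fset_set C -> 0 <= \sum_(i in labels A x) lambda i
    - (#|labels A x|%:R - (x \in \bigcup_i A i)%:R).
  rewrite in_fset_set// inE subr_ge0 => Cx.
  (* On the union the indicator is 1 and the labels form a nonempty clique; off it every term
     vanishes. *)
  have [xU|/[dup] xU /labels_out ->] := boolP (x \in \bigcup_i A i).
    by apply: lambda_clique; rewrite ?labels_neq0//;
      apply: (clique_labels C_kissing t_inj X_kissing Cx).
  by rewrite big_set0 cards0 subr0.
have layer_ge0 i : 0 <= lambda i * (alpha i - (ncard (A i))%:R).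
  by rewrite mulr_ge0// subr_ge0.
move: gapE; set P := (X in _ = X + _); set L := (X in _ = _ + X).
(* [big_seq] restores the membership in [C] under which [point_ge0] holds. *)
have P_ge0 : 0 <= P by rewrite /P big_seq; exact: sumr_ge0.
have L_ge0 : 0 <= L by exact: sumr_ge0.
move=> gapE; split; first by lra.
split=> [Xeq|[Peq Leq]].
  (* Equality means [P + L = 0]; both sums are nonnegative, so both vanish, and then so does each of
     their terms. *)
  have P0 : P = 0 by lra.
  have L0 : L = 0 by lra.
  split=> [x [i _ Aix]|i lami].
    have xC : x \in fset_set C by rewrite in_fset_set// inE; exact: A_sub Aix.
    have /eqP := P0; rewrite /P big_seq psumr_eq0//.
    move=> /allP/(_ x xC)/implyP/(_ xC).
    by rewrite subr_eq0 mem_set => [/eqP|]; last by exists i.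
  have /(_ i isT)/eqP := psumr_eq0P (fun i _ => layer_ge0 i) L0.
  by rewrite mulf_eq0 gt_eqF//= subr_eq0 => /eqP.
have P0 : P = 0.
  apply: big1 => x _; apply/eqP; rewrite subr_eq0; apply/eqP.
  have [xU|/[dup] xU /labels_out ->] := boolP (x \in \bigcup_i A i).
    by apply: Peq; rewrite inE in xU.
  by rewrite big_set0 cards0 subr0.
have L0 : L = 0.
  (* A label of weight 0 contributes nothing, whatever the slack in its cardinality bound. *)
  apply: big1 => i _; have := lambda_ge0 i; rewrite le_eqVlt => /predU1P[<-|].
    by rewrite mul0r.
  by move=> /Leq ->; rewrite subrr mulr0.
by lra.
Qed.
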